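(* For every integer $k\ge2$, the $2k$-beachball graph $B_{2k}$ is common.
   Context: For a graph $H$ and a graphon $W$ (a measurable symmetric function $W:[0,1]^2\to[0,1]$), let $t_H(W)=\int_{[0,1]^{V(H)}}\prod_{uv\in E(H)}W(x_u,x_v)\,dx$ and $m_H(W)=t_H(W)+t_H(1-W)$. A graph $H$ is common if $m_H(W)\ge 2^{1-e(H)}$ for every graphon $W$. The $m$-beachball $B_m$ is obtained by gluing two copies of the $m$-wheel along their rim $m$-cycle; equivalently, it is an $m$-cycle together with two non-adjacent new vertices each adjacent to all $m$ vertices of the cycle (so $B_4=K_{2,2,2}$). *)

(* Defs.v *)
From HB Require Import structures.
From mathcomp Require Import all_boot all_order all_algebra.
From mathcomp Require Import all_classical all_reals all_analysis.
Set Implicit Arguments. Unset Strict Implicit. Unset Printing Implicit Defensive.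
Import Order.TTheory GRing.Theory Num.Theory.
Local Open Scope classical_set_scope.
Local Open Scope ring_scope.

(* A graph on vertex set {0,...,n-1} given by its list of edges. *)
Record graph := Graph { gverts : nat; gedges : seq (nat * nat) }.

Definition e (H : graph) : nat := size (gedges H).

Section Graphon.
Variable R : realType.

Definition graphon (W : R -> R -> R) : Prop :=
  measurable_fun (`[0%R, 1%R]%classic `*` `[0%R, 1%R]%classic : set (R * R))
    (fun p : R * R => W p.1 p.2) /\
  (forall x y, x \in `[0%R, 1%R] -> y \in `[0%R, 1%R] -> W x y = W y x) /\
  (forall x y, x \in `[0%R, 1%R] -> y \in `[0%R, 1%R] -> 0 <= W x y <= 1).

(* Integral over [0,1]^n of f (a function of an assignment x : nat -> R,
   depending only on x_0..x_{n-1}), computed as an iterated Lebesgue integral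
   (Tonelli: equals the integral over the product for nonnegative measurable f). *)
Fixpoint cube_integral (n : nat) (f : (nat -> R) -> \bar R) : \bar R :=
  match n with
  | 0 => f (fun _ => 0)
  | n'.+1 => (\int[@lebesgue_measure R]_(x in `[0%R, 1%R])
               cube_integral n' (fun g => f (fun i => if i == n' then x else g i)))%E
  end.

Definition t (H : graph) (W : R -> R -> R) : \bar R :=
  cube_integral (gverts H)
    (fun x => (\prod_(uv <- gedges H) W (x uv.1) (x uv.2))%:E).

Definition m (H : graph) (W : R -> R -> R) : \bar R :=
  (t H W + t H (fun x y => 1 - W x y)%R)%E.

Definition common (H : graph) : Prop :=
  forall W, graphon W -> ((2 / 2 ^+ e H)%:E <= m H W)%E.

End Graphon.

(* The m-beachball: cycle on vertices 0..m-1 (edges {i, i+1 mod m}),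
   plus two non-adjacent poles m and m+1 each adjacent to all cycle vertices. *)
Definition beachball (mm : nat) : graph :=
  Graph mm.+2
    ([seq (i, (i.+1 %% mm)%N) | i <- iota 0 mm] ++
     [seq (mm, i) | i <- iota 0 mm] ++
     [seq (mm.+1, i) | i <- iota 0 mm]).

(* Main.v *)
Require Import Defs.
From mathcomp Require Import all_boot all_order all_algebra.
From mathcomp Require Import all_classical all_reals all_analysis.
From mathcomp Require Import measurable_realfun zify ring lra.
Set Implicit Arguments. Unset Strict Implicit. Unset Printing Implicit Defensive.
Import Order.TTheory GRing.Theory Num.Theory.
Local Open Scope classical_set_scope.
Local Open Scope ring_scope.

(* Fix the poles [a], [b] and let [f u = W a u * W b u], [d] its integral (the
   codegree) and [T] the integral of [f u * W u v * f v].  The density of even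
   cycles weighted by [f] is a trace, and comparing it with walks, whose moments
   are log-convex, bounds it below by [(T / d) ^ (2k)].  With [l = 8 T / d] and
   [s = 4 d], Bernoulli gives [l ^ (2k) >= 1 + k / 2 * (l ^ 4 - 1)] and Young gives
   [l ^ 4 >= 4 l s - 2 s - s ^ 2], where [l s = 32 T] has no denominator, so this
   can be integrated over the poles.  By Fubini the integral of [T] is that of
   [W c ^ 2], [c] being the codegree.  Summing over both colours leaves a polynomial
   in [V = 1 - 2 W], its degrees and its codegrees, bounded below pointwise by a
   function whose integral is [2] plus a multiple of the mean squared degree of [V]. *)

(** * Bounded measurable functions *)

Section BoundedMeasurable.
Context {R : realType}.
Implicit Types (d : measure_display).

(** On a probability space such functions are integrable, and they are stable under every operation
    used below. Integrability conditions thus reduce to the syntactic search [bm]. *)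
Definition bounded_measurable d (X : measurableType d) (f : X -> R) : Prop :=
  measurable_fun setT f /\ exists M, forall x, `|f x| <= M.

Lemma bm_cst d (X : measurableType d) (c : R) :
  bounded_measurable (fun _ : X => c).
Proof. by split; [exact: measurable_cst | exists `|c|]. Qed.

Lemma bmD d (X : measurableType d) (f g : X -> R) :
  bounded_measurable f -> bounded_measurable g ->
  bounded_measurable (fun x => f x + g x).
Proof.
move=> [mf [M hM]] [mg [N hN]]; split; first exact: measurable_funD.
by exists (M + N) => x; rewrite (le_trans (ler_normD _ _)) ?lerD.
Qed.

Lemma bmM d (X : measurableType d) (f g : X -> R) :
  bounded_measurable f -> bounded_measurable g ->
  bounded_measurable (fun x => f x * g x).
Proof.
move=> [mf [M hM]] [mg [N hN]]; split; first exact: measurable_funM.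
by exists (M * N) => x; rewrite normrM ler_pM.
Qed.

Lemma bmN d (X : measurableType d) (f : X -> R) :
  bounded_measurable f -> bounded_measurable (fun x => - f x).
Proof.
move=> bf; rewrite (_ : (fun x => - f x) = (fun x => (-1) * f x)).
  exact: bmM (bm_cst _ _) bf.
by apply/funext => x; rewrite mulN1r.
Qed.

Lemma bmX d (X : measurableType d) (f : X -> R) n :
  bounded_measurable f -> bounded_measurable (fun x => f x ^+ n).
Proof.
move=> bf; elim: n => [|n IH]; first exact: bm_cst.
rewrite (_ : (fun x => _) = (fun x => f x * f x ^+ n)); first exact: bmM.
by apply/funext => x; rewrite exprS.
Qed.

Lemma bm_comp d d' (X : measurableType d) (Y : measurableType d')
    (f : Y -> R) (h : X -> Y) :
  bounded_measurable f -> measurable_fun setT h ->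
  bounded_measurable (fun x => f (h x)).
Proof.
move=> [mf [M hM]] mh; split; first exact: (measurableT_comp mf mh).
by exists M => x.
Qed.

Lemma bm_comp2 d d1 d2 (X : measurableType d) (Y : measurableType d1)
    (Z : measurableType d2) (F : Y -> Z -> R) (h : X -> Y) (l : X -> Z) :
  bounded_measurable (fun p : Y * Z => F p.1 p.2) ->
  measurable_fun setT h -> measurable_fun setT l ->
  bounded_measurable (fun x => F (h x) (l x)).
Proof.
move=> bF mh ml.
exact: (@bm_comp _ _ _ _ _ (fun x => (h x, l x)) bF (measurable_fun_pair mh ml)).
Qed.

Lemma measurable_fst_comp d d1 d2 (X : measurableType d) (Y : measurableType d1)
    (Z : measurableType d2) (h : X -> Y * Z) :
  measurable_fun setT h -> measurable_fun setT (fun x => (h x).1).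
Proof. exact: measurableT_comp measurable_fst. Qed.

Lemma measurable_snd_comp d d1 d2 (X : measurableType d) (Y : measurableType d1)
    (Z : measurableType d2) (h : X -> Y * Z) :
  measurable_fun setT h -> measurable_fun setT (fun x => (h x).2).
Proof. exact: measurableT_comp measurable_snd. Qed.

End BoundedMeasurable.

(** * Integration against a probability measure *)

Section Expectation.
Context {R : realType} {d : measure_display} {T : measurableType d}.
Variable P : probability T R.
Implicit Types f g : T -> R.

Local Notation "'E_' x , F" := (\int[P]_x F)%R
  (at level 200, x name, F at level 200).

Lemma bm_integrable f : bounded_measurable f -> P.-integrable setT (EFin \o f).
Proof.
move=> [mf [M hM]]; apply: measurable_bounded_integrable => //.
  exact: fin_num_fun_lty.
by exists M; split; [rewrite num_real | move=> x Mx t _; rewrite /= (le_trans (hM t)) ?ltW].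
Qed.

Lemma ED f g : bounded_measurable f -> bounded_measurable g ->
  (E_ x, f x + g x) = (E_ x, f x) + (E_ x, g x).
Proof. by move=> bf bg; apply: RintegralD => //; exact: bm_integrable. Qed.

Lemma EZ c f : bounded_measurable f -> (E_ x, c * f x) = c * (E_ x, f x).
Proof. by move=> bf; apply: RintegralZl => //; exact: bm_integrable. Qed.

Lemma EZr c f : bounded_measurable f -> (E_ x, f x * c) = (E_ x, f x) * c.
Proof. by move=> bf; apply: RintegralZr => //; exact: bm_integrable. Qed.

Lemma Ecst c : (E_ x, c) = c.
Proof.
have P1 : fine (P setT) = 1 by rewrite probability_setT.
by rewrite Rintegral_cst// -[RHS]mulr1; congr (_ * _).
Qed.

Lemma Ele f g : bounded_measurable f -> bounded_measurable g ->
  (forall x, f x <= g x) -> (E_ x, f x) <= (E_ x, g x).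
Proof. by move=> bf bg fg; apply: le_Rintegral => //; exact: bm_integrable. Qed.

Lemma Ege0 f : (forall x, 0 <= f x) -> 0 <= (E_ x, f x).
Proof. by move=> f0; exact: Rintegral_ge0. Qed.

Lemma Eeq f g : f =1 g -> (E_ x, f x) = (E_ x, g x).
Proof. by move=> fg; congr Rintegral; exact/funext. Qed.

Lemma EFinE f : bounded_measurable f ->
  (\int[P]_x (f x)%:E)%E = (E_ x, f x)%:E.
Proof.
by move=> bf; rewrite /Rintegral fineK//; apply: integrable_fin_num => //; exact: bm_integrable.
Qed.

Lemma bm_section d' (X : measurableType d') (F : X -> T -> R) x :
  bounded_measurable (fun p : X * T => F p.1 p.2) ->
  bounded_measurable (F x).
Proof. by move=> bF; apply: (bm_comp2 bF). Qed.

Lemma bm_section2 d' (X : measurableType d') (F : T -> X -> R) x :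
  bounded_measurable (fun p : T * X => F p.1 p.2) ->
  bounded_measurable (F^~ x).
Proof. by move=> bF; apply: (bm_comp2 bF). Qed.

(** Measurability comes from Tonelli's theorem for nonnegative functions: [F] is shifted up by its
    bound [M], and the constant is subtracted afterwards. *)
Lemma bmE d' (X : measurableType d') (F : X -> T -> R) :
  bounded_measurable (fun p : X * T => F p.1 p.2) ->
  bounded_measurable (fun x => E_ z, F x z).
Proof.
move=> bF; have [mF [M hM]] := bF.
have FM x z : 0 <= F x z + M.
  by rewrite -lerBlDr sub0r; have := hM (x, z); rewrite ler_norml => /andP[].
split.
  rewrite (_ : (fun x => _) = (fun x => (E_ z, F x z + M) - M)); last first.
    apply/funext => x; rewrite ED ?Ecst ?addrK//; [exact: bm_section|exact: bm_cst].
  apply: measurable_funB => //.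
  apply: (measurableT_comp (fine_measurable measurableT)).
  apply: (@measurable_fun_fubini_tonelli_F _ _ _ _ _ P
    (fun p : X * T => (F p.1 p.2 + M)%:E)) => [|p]; last by rewrite lee_fin.
  by apply/measurable_EFinP; exact: measurable_funD.
exists M => x; apply: (le_trans (le_normr_Rintegral _ _)) => //.
  exact/bm_integrable/bm_section.
rewrite -[leRHS]Ecst; apply: Ele => [| |z]; last exact: (hM (x, z)).
  by have /(bm_section x) [m1 [K hK]] := bF; split; [exact: measurableT_comp|exists K => z; rewrite normr_id].
exact: bm_cst.
Qed.

End Expectation.

Ltac measurable_proj :=
  repeat first [ exact: measurable_id | exact: measurable_cst
               | apply: measurable_fst_comp | apply: measurable_snd_comp ].

(** The goal is eta-expanded so that a function or kernel from the context can be recognised under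
    projections. Hypotheses of the form [forall n] serve families such as [walk] and [degree]. *)
Ltac bm_atom :=
  match goal with
  | |- bounded_measurable ?f => change (bounded_measurable (fun x => f x))
  end; cbv beta;
  match goal with
  | H : bounded_measurable (fun p => ?F p.1 p.2)
    |- bounded_measurable (fun x => ?F (@?h x) (@?l x)) =>
      apply: (@bm_comp2 _ _ _ _ _ _ _ F h l H); measurable_proj
  | H : forall n, bounded_measurable _
    |- bounded_measurable (fun x => ?G (@?h x) (@?l x)) =>
      apply: (@bm_comp2 _ _ _ _ _ _ _ G h l (H _)); measurable_proj
  | H : bounded_measurable ?f |- bounded_measurable (fun x => ?f (@?h x)) =>
      apply: (@bm_comp _ _ _ _ _ f h H); measurable_proj
  | H : forall n, bounded_measurable _
    |- bounded_measurable (fun x => ?g (@?h x)) =>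
      apply: (@bm_comp _ _ _ _ _ g h (H _)); measurable_proj
  end.

Ltac bm := repeat first
  [ exact: bm_cst | bm_atom
  | apply: bmE | apply: bmX | apply: bmM | apply: bmN | apply: bmD ].

(** * Exchange of integrals *)

Section Fubini.
Context {R : realType} {d1 d2 : measure_display} {S : measurableType d1} {T : measurableType d2}.
Variables (P : probability S R) (Q : probability T R).

(** The shift by [M] makes the integrand nonnegative, so that Tonelli's theorem applies; [M] is then
    cancelled on both sides. *)
Lemma E_swap (F : S -> T -> R) : bounded_measurable (fun p : S * T => F p.1 p.2) ->
  (\int[P]_x (\int[Q]_y F x y) = \int[Q]_y (\int[P]_x F x y))%R.
Proof.
move=> bF; have [mF [M hM]] := bF.
have FM x z : 0 <= F x z + M.
  by rewrite -lerBlDr sub0r; have := hM (x, z); rewrite ler_norml => /andP[].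
have bx x : bounded_measurable (F x) by exact: bm_section.
have by_ y : bounded_measurable (F^~ y) by exact: bm_section2.
have bF' : bounded_measurable (fun p : S * T => F p.1 p.2 + M) by apply: bmD => //; exact: bm_cst.
have bG' : bounded_measurable (fun p : T * S => F p.2 p.1 + M).
  by apply: (bm_comp2 (F := fun x y => F x y + M) bF').
have bG : bounded_measurable (fun p : T * S => F p.2 p.1) by apply: (bm_comp2 bF).
have bM d (X : measurableType d) : bounded_measurable (fun _ : X => M) by exact: bm_cst.
have bxM x : bounded_measurable (fun y => F x y + M) by exact: bmD.
have byM y : bounded_measurable (fun x => F x y + M) by exact: bmD.
have eL : (\int[P]_x (\int[Q]_y F x y) + M = \int[P]_x (\int[Q]_y (F x y + M)))%R.
  rewrite -[in LHS](Ecst P M) -ED //; last exact: bmE.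
  by apply: Eeq => x; rewrite -[in LHS](Ecst Q M) -ED.
have eR : (\int[Q]_y (\int[P]_x F x y) + M = \int[Q]_y (\int[P]_x (F x y + M)))%R.
  rewrite -[in LHS](Ecst Q M) -ED //; last exact: (bmE _ (F := fun y x => F x y)).
  by apply: Eeq => y; rewrite -[in LHS](Ecst P M) -ED.
apply: (addIr M); rewrite eL eR; apply: EFin_inj.
rewrite -EFinE; last exact: (bmE _ (F := fun x y => F x y + M)).
rewrite -EFinE; last exact: (bmE _ (F := fun y x => F x y + M)).
transitivity (\int[P]_x \int[Q]_y (F x y + M)%:E)%E.
  by apply: eq_integral => x _; rewrite EFinE.
transitivity (\int[Q]_y \int[P]_x (F x y + M)%:E)%E.
  apply: (fubini_tonelli (fun p : S * T => (F p.1 p.2 + M)%:E)) => [|p].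
    by apply/measurable_EFinP; case: bF'.
  by rewrite lee_fin.
by apply: eq_integral => y _; rewrite EFinE.
Qed.

End Fubini.

(** * Even cycles in a weighted kernel *)

Section WeightedCycle.
Context {R : realType} {d : measure_display} {T : measurableType d}.
Variables (P : probability T R) (phi : T -> R) (K : T -> T -> R).

Local Notation "'E_' x , F" := (\int[P]_x F)%R
  (at level 200, x name, F at level 200).

(** Here [n] counts interior vertices, the only ones weighted by [phi]; the walk has [n.+1] edges.
    Weighting the base point of a closed walk as well gives a weighted cycle. *)
Fixpoint walk n (x y : T) : R :=
  if n is n'.+1 then E_ z, walk n' x z * phi z * K z y else K x y.

(** Iterates, on the constant 1, of the integral operator with kernel [phi y * K x y]. *)
Fixpoint degree n (x : T) : R :=
  if n is n'.+1 then E_ y, phi y * K x y * degree n' y else 1.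

Hypothesis bphi : bounded_measurable phi.
Hypothesis bK : bounded_measurable (fun p : T * T => K p.1 p.2).
Hypothesis Ksym : forall x y, K x y = K y x.
Hypothesis phi_ge0 : forall x, 0 <= phi x.

Lemma bm_walk n : bounded_measurable (fun p : T * T => walk n p.1 p.2).
Proof. by elim: n => [//|n IH] /=; bm. Qed.

Lemma bm_degree n : bounded_measurable (degree n).
Proof. by elim: n => [|n IH] /=; bm. Qed.

Let bw := bm_walk.
Let bd := bm_degree.

Let walkS n x y : walk n.+1 x y = E_ z, walk n x z * phi z * K z y.
Proof. by []. Qed.

Let degreeS n x : degree n.+1 x = E_ y, phi y * K x y * degree n y.
Proof. by []. Qed.

(** The junction [z] becomes an interior vertex, hence the successor. *)
Lemma walk_cat m n x y :
  walk (m + n).+1 x y = E_ z, walk m x z * phi z * walk n z y.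
Proof.
elim: n y => [|n IH] y; first by rewrite addn0.
transitivity (E_ w, E_ z, walk m x z * phi z * walk n z w * (phi w * K w y)).
  rewrite addnS walkS; apply: Eeq => w.
  by rewrite IH -mulrA -EZr//; bm.
rewrite E_swap; last by bm.
apply: Eeq => z /=; rewrite -EZ; last by bm.
by apply: Eeq => w; ring.
Qed.

Lemma walk_sym n x y : walk n x y = walk n y x.
Proof.
elim: n x y => [//|n IH] x y.
rewrite -{2}(add0n n) walk_cat /=; apply: Eeq => z.
by rewrite (IH z x) (Ksym y z); ring.
Qed.

Lemma degree_walk n x : degree n.+1 x = E_ y, phi y * walk n y x.
Proof.
elim: n x => [|n IH] x; first by rewrite /=; apply: Eeq => y; rewrite mulr1 Ksym.
transitivity (E_ y, E_ z, phi z * walk n z y * (phi y * K y x)).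
  rewrite degreeS; apply: Eeq => y; rewrite IH Ksym mulrC -EZr; last by bm.
  by [].
rewrite E_swap; last by bm.
apply: Eeq => z /=; rewrite -EZ; last by bm.
by apply: Eeq => w; ring.
Qed.

(** The operator behind [degree] is self-adjoint for the inner product weighted by [phi], as [K] is
    symmetric. *)
Lemma degree_selfadjoint m n :
  (E_ x, phi x * degree m.+1 x * degree n x) =
  (E_ x, phi x * degree m x * degree n.+1 x).
Proof.
transitivity (E_ x, E_ y, phi x * phi y * K x y * degree m y * degree n x).
  apply: Eeq => x /=; rewrite -EZ; last by bm.
  rewrite -EZr; last by bm.
  by apply: Eeq => y; ring.
rewrite E_swap; last by bm.
apply: Eeq => y /=; rewrite -EZ; last by bm.
by apply: Eeq => x; rewrite Ksym; ring.
Qed.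

Local Notation mass := (E_ x, phi x).
Local Notation edge := (E_ x, phi x * degree 1 x).
Local Notation moment n := (E_ x, phi x * degree n x ^+ 2).

Let moment0 : moment 0 = mass.
Proof. by apply: Eeq => x; rewrite /= expr1n mulr1. Qed.

(** Log-convexity of moments without division; [r] is the weighted mean degree. The base case is the
    variance of [degree 1]. The step expands the square of [degree n.+2 - r ^+ 2 * degree n] and
    uses the induction hypothesis multiplied by [r ^+ 2]. *)
Lemma moment_growth r n : r * mass = edge -> r ^+ 2 * moment n <= moment n.+1.
Proof.
move=> re; elim: n => [|n IH].
  have : 0 <= E_ x, phi x * (degree 1 x - r) ^+ 2.
    by apply: Ege0 => x; rewrite mulr_ge0 ?sqr_ge0.
  rewrite (Eeq _ (g := fun x => phi x * degree 1 x ^+ 2 +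
      ((- (2 * r)) * (phi x * degree 1 x) + r ^+ 2 * phi x))); last by move=> x; ring.
  rewrite ED; [|by bm..].
  rewrite ED; [|by bm..].
  rewrite EZ; [|by bm].
  rewrite EZ; [|by bm].
  rewrite -re moment0.
  by move=> h; rewrite -subr_ge0; congr (0 <= _): h; ring.
have : 0 <= E_ x, phi x * (degree n.+2 x - r ^+ 2 * degree n x) ^+ 2.
  by apply: Ege0 => x; rewrite mulr_ge0 ?sqr_ge0.
rewrite (Eeq _ (g := fun x => phi x * degree n.+2 x ^+ 2 +
    ((- (2 * r ^+ 2)) * (phi x * degree n.+2 x * degree n x) +
     r ^+ 4 * (phi x * degree n x ^+ 2)))); last by move=> x; ring.
rewrite ED; [|by bm..].
rewrite ED; [|by bm..].
rewrite EZ; [|by bm].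
rewrite EZ; [|by bm].
(* The cross term becomes the moment of order [n.+1]. *)
rewrite degree_selfadjoint.
rewrite (Eeq _ (f := fun x => phi x * degree n.+1 x * degree n.+1 x)
  (g := fun x => phi x * degree n.+1 x ^+ 2)) => [|x]; last by ring.
have r20 : 0 <= r ^+ 2 by exact: sqr_ge0.
move: IH; set a := (\int[P]_x (phi x * degree n x ^+ 2))%R.
set b := (\int[P]_x (phi x * degree n.+1 x ^+ 2))%R.
set c := (\int[P]_x (phi x * degree n.+2 x ^+ 2))%R => IH.
have := ler_wpM2l r20 IH.
have -> : r ^+ 4 = r ^+ 2 * r ^+ 2 by rewrite -exprD.
by move: (r ^+ 2) => s; lra.
Qed.

(** Cutting a cycle on [2k + 2] vertices at two opposite vertices [x], [z] gives [walk k x z ^+ 2].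
    Cauchy-Schwarz in [x] then compares its integral with [degree k.+1 z ^+ 2]. *)
Lemma cycle_moment k :
  moment k.+1 <= mass * (E_ x, phi x * walk (k + k).+1 x x).
Proof.
have -> : (E_ x, phi x * walk (k + k).+1 x x) =
    E_ z, phi z * E_ x, phi x * walk k x z ^+ 2.
  transitivity (E_ x, E_ z, phi x * phi z * walk k x z ^+ 2).
    apply: Eeq => x; rewrite walk_cat -EZ; last by bm.
    by apply: Eeq => z; rewrite (walk_sym k z x); ring.
  rewrite E_swap; last by bm.
  apply: Eeq => z; rewrite -EZ; last by bm.
  by apply: Eeq => x; ring.
rewrite -EZ; last by bm.
apply: Ele; [by bm|by bm|] => z.
rewrite [leRHS]mulrCA ler_wpM2l// degree_walk.
set g := (\int[P]_x (phi x * walk k x z))%R.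
set q := (\int[P]_x (phi x * walk k x z ^+ 2))%R.
(* Cauchy-Schwarz is obtained from this quadratic in [t], whose minimum is at [g / mass] when the
   mass is positive. *)
have quad t : 0 <= q - 2 * t * g + t ^+ 2 * mass.
  have : 0 <= E_ x, phi x * (walk k x z - t) ^+ 2.
    by apply: Ege0 => x; rewrite mulr_ge0 ?sqr_ge0.
  rewrite (Eeq _ (g := fun x => phi x * walk k x z ^+ 2 +
      ((- (2 * t)) * (phi x * walk k x z) + t ^+ 2 * phi x))); last by move=> x; ring.
  rewrite ED; [|by bm..].
  rewrite ED; [|by bm..].
  rewrite EZ; [|by bm].
  rewrite EZ; [|by bm].
  by rewrite -/g -/q => h; congr (0 <= _): h; ring.
have q0 : 0 <= q by apply: Ege0 => x; rewrite mulr_ge0 ?sqr_ge0.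
have [m0|m0] := eqVneq mass 0.
  have [->|g0] := eqVneq g 0; first by rewrite expr0n m0 mul0r.
  (* Without mass the quadratic is affine in [t]; this value would give [q - 2 * (q + 1) >= 0],
     against [q >= 0]. *)
  have := quad ((q + 1) / g); rewrite m0 mulr0 addr0.
  rewrite (_ : 2 * _ * g = 2 * (q + 1)); last by field.
  lra.
have m_gt0 : 0 < mass by rewrite lt_neqAle eq_sym m0 /=; apply: Ege0.
have := quad (g / mass).
rewrite (_ : q - _ + _ = (mass * q - g ^+ 2) / mass); last by field.
by rewrite pmulr_lge0 ?invr_gt0// subr_ge0.
Qed.

(** Iterating [moment_growth] from the zeroth moment, which is the mass, yields
    [mass * r ^+ (2 * n) <= moment n]. The mass then cancels in [cycle_moment]. *)
Lemma weighted_even_cycle r k : 0 < mass -> r * mass = edge ->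
  r ^+ (2 * k.+1) <= E_ x, phi x * walk (k + k).+1 x x.
Proof.
move=> m_gt0 re; rewrite -(ler_pM2l m_gt0); apply: le_trans (cycle_moment k).
elim: k.+1 => {k} [|n IH].
  by rewrite muln0 expr0 mulr1 moment0.
apply: le_trans (moment_growth n re).
by rewrite mulnS exprD mulrCA ler_wpM2l ?sqr_ge0.
Qed.

End WeightedCycle.

(** * The density inequality *)

(** Tangent bound at [x = 1] in the variable [x ^+ 2]. Each induction step leaves [(x - 1) ^+ 2]
    times a nonnegative factor. *)
Lemma bernoulli_sqr (R : realFieldType) (x : R) n : 0 <= x ->
  1 + n.+2%:R / 2 * (x ^+ 2 - 1) <= x ^+ n.+2.
Proof.
move=> x0; elim: n => [|n IH]; first by rewrite divff ?pnatr_eq0// mul1r; lra.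
rewrite exprS; apply: le_trans (ler_wpM2l x0 IH).
have n0 : 0 <= n%:R :> R by exact: ler0n.
rewrite -subr_ge0 -[n.+3]addn3 -[n.+2]addn2 !natrD.
have -> : x * (1 + (n%:R + 2) / 2 * (x ^+ 2 - 1)) -
    (1 + (n%:R + 3) / 2 * (x ^+ 2 - 1)) =
    (x - 1) ^+ 2 * ((n%:R + 2) * (x + 1) - 1) / 2 by field.
rewrite divr_ge0// mulr_ge0 ?sqr_ge0//.
have : 0 <= n%:R * x by rewrite mulr_ge0.
lra.
Qed.

(** Equality holds at [l = s = 1], the values for the constant graphon 1/2. As a function of [s] the
    left side has maximum [(2 * l - 1) ^+ 2], attained at [s = 2 * l - 1]. *)
Lemma quartic_young (R : realFieldType) (l s : R) : 0 <= l -> 0 <= s ->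
  4 * l * s - 2 * s - s ^+ 2 <= l ^+ 4.
Proof.
move=> l0 s0; rewrite -subr_ge0.
(* For small [l] the factor [l ^+ 2 + 2 * l - 1] used below can be negative, but there the left side
   is itself nonpositive. *)
have [l1|l1] := lerP l (1 / 2).
  have : 0 <= s * (1 - 2 * l) by rewrite mulr_ge0//; lra.
  have := exprn_ge0 4 l0; have := sqr_ge0 s; lra.
have -> : l ^+ 4 - (4 * l * s - 2 * s - s ^+ 2) =
  (s - (2 * l - 1)) ^+ 2 + (l ^+ 2 + 2 * l - 1) * (l - 1) ^+ 2 by ring.
by rewrite addr_ge0 ?sqr_ge0// mulr_ge0 ?sqr_ge0//; have := sqr_ge0 l; lra.
Qed.

(** * Bounds for one colour with the poles fixed *)

Section Beachball.
Context {R : realType} {d : measure_display} {T : measurableType d}.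
Variable P : probability T R.

Local Notation "'E_' x , F" := (\int[P]_x F)%R
  (at level 200, x name, F at level 200).

Section OneColour.
Variable W : T -> T -> R.

Definition common_nbhd (a b u : T) : R := W a u * W b u.

Definition codegree (a b : T) : R := E_ u, common_nbhd a b u.

Definition nbhd_edges (a b : T) : R :=
  E_ u, common_nbhd a b u * degree P (common_nbhd a b) W 1 u.

(** The base point [u] and [n] interior vertices form the rim, so this is the density of the
    beachball with [n.+1] rim vertices, conditioned on its poles. *)
Definition nbhd_cycles n (a b : T) : R :=
  E_ u, common_nbhd a b u * walk P (common_nbhd a b) W n u u.

Hypothesis bW : bounded_measurable (fun p : T * T => W p.1 p.2).
Hypothesis Wsym : forall x y, W x y = W y x.
Hypothesis W01 : forall x y, 0 <= W x y <= 1.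

Lemma bm_common_nbhd a b : bounded_measurable (common_nbhd a b).
Proof. by rewrite /common_nbhd; bm. Qed.

Lemma common_nbhd01 a b u : 0 <= common_nbhd a b u <= 1.
Proof.
have /andP[a0 a1] := W01 a u; have /andP[b0 b1] := W01 b u.
by rewrite mulr_ge0//= mulr_ile1.
Qed.

Lemma bm_codegree : bounded_measurable (fun p : T * T => codegree p.1 p.2).
Proof. by rewrite /codegree /common_nbhd; bm. Qed.

Lemma bm_nbhd_edges : bounded_measurable (fun p : T * T => nbhd_edges p.1 p.2).
Proof. by rewrite /nbhd_edges /common_nbhd /=; bm. Qed.

(** The poles are integrated too, so measurability has to be joint in poles and endpoints. *)
Lemma bm_walk_param n : bounded_measurable
  (fun p : T * T * (T * T) => walk P (common_nbhd p.1.1 p.1.2) W n p.2.1 p.2.2).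
Proof.
elim: n => [|n IH] /=; first by bm.
rewrite /common_nbhd; apply: bmE; apply: bmM; last by bm.
apply: bmM; last by bm.
apply: (@bm_comp _ _ _ _ _ _ (fun p : T * T * (T * T) * T => (p.1.1, (p.1.2.1, p.2))) IH).
by do ?apply: measurable_fun_pair; measurable_proj.
Qed.

Lemma bm_nbhd_cycles n :
  bounded_measurable (fun p : T * T => nbhd_cycles n p.1 p.2).
Proof.
rewrite /nbhd_cycles; apply: bmE; apply: bmM; first by rewrite /common_nbhd; bm.
apply: (@bm_comp _ _ _ _ _ _ (fun p : T * T * T => (p.1, (p.2, p.2))) (bm_walk_param n)).
by do ?apply: measurable_fun_pair; measurable_proj.
Qed.

Lemma walk_ge0 (phi : T -> R) n x y : (forall z, 0 <= phi z) -> 0 <= walk P phi W n x y.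
Proof.
move=> phi0; elim: n y => [|n IH] y /=; first by case/andP: (W01 x y).
by apply: Ege0 => z; rewrite !mulr_ge0//; case/andP: (W01 z y).
Qed.

Lemma nbhd_cycles_ge0 n a b : 0 <= nbhd_cycles n a b.
Proof.
have phi0 u : 0 <= common_nbhd a b u by case/andP: (common_nbhd01 a b u).
by apply: Ege0 => u; rewrite mulr_ge0// walk_ge0.
Qed.

(** The upper bound makes [nbhd_edges] vanish with the codegree, where no mean degree can be
    formed. *)
Lemma nbhd_edges_le a b : 0 <= nbhd_edges a b <= codegree a b.
Proof.
have bphi := bm_common_nbhd a b.
have phi0 u : 0 <= common_nbhd a b u by case/andP: (common_nbhd01 a b u).
have phi1 u : common_nbhd a b u <= 1 by case/andP: (common_nbhd01 a b u).
have W0 x y : 0 <= W x y by case/andP: (W01 x y).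
have W1 x y : W x y <= 1 by case/andP: (W01 x y).
apply/andP; split.
  apply: Ege0 => u; rewrite mulr_ge0//=; apply: Ege0 => v.
  by rewrite !mulr_ge0.
rewrite /codegree -(Eeq P (f := fun u => common_nbhd a b u * 1)) => [|u]; last exact: mulr1.
rewrite /nbhd_edges /=; apply: Ele; [by bm|by bm|] => u.
rewrite ler_wpM2l// -[leRHS](Ecst P 1); apply: Ele; [by bm|by bm|] => v.
by rewrite mulr1 mulr_ile1.
Qed.

(* [4 l s - 2 s - s ^ 2] for [l] and [s] as in [quartic_young], namely eight times
   the average degree inside the common neighbourhood and four times the codegree. *)
Definition gain (a b : T) : R :=
  128 * nbhd_edges a b - 8 * codegree a b - 16 * codegree a b ^+ 2.

(** The scaling makes both sides equal to 1 for the constant graphon 1/2. *)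
Lemma nbhd_cycles_ge k a b :
  1 + k.+2%:R / 2 * (gain a b - 1) <=
  8 ^+ (2 * k.+2) * nbhd_cycles (k.+1 + k.+1).+1 a b.
Proof.
have bphi := bm_common_nbhd a b.
have phi0 u : 0 <= common_nbhd a b u by case/andP: (common_nbhd01 a b u).
have /andP[e0 ec] := nbhd_edges_le a b.
have [c0|c0] := lerP (codegree a b) 0.
  have ce : codegree a b = 0 by apply/eqP; rewrite eq_le c0 (le_trans e0 ec).
  have ee : nbhd_edges a b = 0 by apply/eqP; rewrite eq_le e0 -ce ec.
  apply: le_trans (mulr_ge0 (exprn_ge0 _ _) (nbhd_cycles_ge0 _ _ _)) => //.
  rewrite /gain ce ee.
  (* The gain is 0 here, so the left side is [1 - k.+2 / 2], which is nonpositive. *)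
  have : 1 <= k.+2%:R / 2 :> R by rewrite ler_pdivlMr// mul1r (ler_nat _ 2).
  lra.
have re : nbhd_edges a b / codegree a b * codegree a b = nbhd_edges a b.
  by rewrite divfK// gt_eqF.
set r := nbhd_edges a b / codegree a b in re.
have r0 : 0 <= r by rewrite divr_ge0// ltW.
have := @weighted_even_cycle _ _ _ P _ W bphi bW Wsym phi0 r k.+1 c0 re.
rewrite -(ler_pM2l (_ : 0 < 8 ^+ (2 * k.+2))) ?exprn_gt0//.
(* Bernoulli is applied to [(8 * r) ^+ 2], leaving the fourth power of [8 * r] for
   [quartic_young]. *)
apply: le_trans; rewrite -exprMn exprM.
apply: le_trans (bernoulli_sqr k (sqr_ge0 _)).
rewrite lerD2l ler_wpM2l ?divr_ge0// lerD2r -exprM.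
apply: le_trans (quartic_young (s := 4 * codegree a b) _ _); last 2 first.
- by rewrite mulr_ge0.
- by rewrite mulr_ge0// ltW.
by rewrite /gain -re le_eqVlt; apply/orP; left; apply/eqP; ring.
Qed.

(** Both sides are the density of [K_4] minus the edge [ab]. Once [u] and [v] are fixed, [a] and [b]
    are independent and each contributes a codegree. *)
Lemma E_nbhd_edges : (E_ a, E_ b, nbhd_edges a b) =
  E_ u, E_ v, W u v * codegree u v ^+ 2.
Proof.
pose F a b u v := W a u * W b u * (W a v * W b v * W u v).
transitivity (E_ a, E_ b, E_ u, E_ v, F a b u v).
  apply: Eeq => a; apply: Eeq => b; apply: Eeq => u.
  rewrite /= -EZ; last by rewrite /common_nbhd; bm.
  by apply: Eeq => v; rewrite /common_nbhd mulr1.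
transitivity (E_ a, E_ u, E_ b, E_ v, F a b u v).
  by apply: Eeq => a; rewrite E_swap//; rewrite /F; bm.
rewrite E_swap; last by rewrite /F; bm.
transitivity (E_ u, E_ a, E_ v, E_ b, F a b u v).
  by apply: Eeq => u; apply: Eeq => a; rewrite E_swap//; rewrite /F; bm.
apply: Eeq => u; rewrite E_swap; last by rewrite /F; bm.
apply: Eeq => v; rewrite expr2 mulrA.
transitivity (E_ a, W u v * codegree u v * (W u a * W v a)).
  apply: Eeq => a; rewrite [RHS]mulrAC -EZ; last by rewrite /common_nbhd; bm.
  by apply: Eeq => b; rewrite /F /common_nbhd !(Wsym a) !(Wsym b); ring.
by rewrite EZ//; bm.
Qed.

End OneColour.
End Beachball.

(** * Averaging over the poles and adding the two colours *)

Section TwoColourBeachball.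
Context {R : realType} {d : measure_display} {T : measurableType d}.
Variable P : probability T R.

Local Notation "'E_' x , F" := (\int[P]_x F)%R
  (at level 200, x name, F at level 200).

(** The pointwise bounds are affine with a common slope [w], so only the mean of [g + g']
    matters. *)
Lemma E_affine_lower_bound (F F' g g' : T -> T -> R) (c w : R) :
  bounded_measurable (fun p : T * T => F p.1 p.2) ->
  bounded_measurable (fun p : T * T => F' p.1 p.2) ->
  bounded_measurable (fun p : T * T => g p.1 p.2) ->
  bounded_measurable (fun p : T * T => g' p.1 p.2) ->
  0 < c -> 0 <= w ->
  2 <= (E_ x, E_ y, g x y + g' x y) ->
  (forall x y, 1 + w * (g x y - 1) <= c * F x y) ->
  (forall x y, 1 + w * (g' x y - 1) <= c * F' x y) ->
  2 / c <= (E_ x, E_ y, F x y) + (E_ x, E_ y, F' x y).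
Proof.
move=> bF bF' bg bg' c0 w0 E_gain h h'.
rewrite ler_pdivrMr// mulrC -(ED P (f := fun x => E_ y, F x y)); [|by bm..].
rewrite -EZ; last by bm.
apply: (@le_trans _ _ (E_ x, (2 - 2 * w) + w * (E_ y, g x y + g' x y))).
  rewrite ED; [|by bm..].
  rewrite Ecst EZ; last by bm.
  by have := ler_wpM2l w0 E_gain; lra.
apply: Ele; [by bm|by bm|] => x.
rewrite -(ED P (f := F x)); [|by bm..].
rewrite -(EZ P c); last by bm.
rewrite -(EZ P w); last by bm.
rewrite -[X in X + _](Ecst P) -ED; [|by bm..].
apply: Ele; [by bm|by bm|] => y.
by have := h x y; have := h' x y; lra.
Qed.

Section TwoColours.
Variable W : T -> T -> R.
Hypothesis bW : bounded_measurable (fun p : T * T => W p.1 p.2).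
Hypothesis Wsym : forall x y, W x y = W y x.
Hypothesis W01 : forall x y, 0 <= W x y <= 1.

Let W' x y := 1 - W x y.
(** Exchanging the colours negates [V], hence negates the degrees [v] and preserves the codegrees
    [q]. *)
Let V x y := 1 - 2 * W x y.
Let v x := E_ y, V x y.
Let q x y := E_ z, V x z * V y z.

Let bV : bounded_measurable (fun p : T * T => V p.1 p.2).
Proof. by rewrite /V; bm. Qed.
Let bW' : bounded_measurable (fun p : T * T => W' p.1 p.2).
Proof. by rewrite /W'; bm. Qed.
Let bv : bounded_measurable v.
Proof. by rewrite /v; bm. Qed.
Let bq : bounded_measurable (fun p : T * T => q p.1 p.2).
Proof. by rewrite /q; bm. Qed.
Let W'sym x y : W' x y = W' y x.
Proof. by rewrite /W' Wsym. Qed.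
Let W'01 x y : 0 <= W' x y <= 1.
Proof. by have := W01 x y; rewrite /W'; lra. Qed.
Let Vsym x y : V x y = V y x.
Proof. by rewrite /V Wsym. Qed.

Let codegreeE x y : codegree P W x y = (1 - (v x + v y) + q x y) / 4.
Proof.
rewrite /codegree (Eeq _ (g := fun z =>
  (1 / 4 + ((- (1 / 4)) * (V x z + V y z) + (1 / 4) * (V x z * V y z))))); last first.
  by move=> z; rewrite /common_nbhd /V; field.
rewrite ED; [|by bm..].
rewrite ED; [|by bm..].
rewrite (EZ P (- (1 / 4))); [|by bm].
rewrite (EZ P (1 / 4)); [|by bm].
rewrite ED; [|by bm..].
by rewrite Ecst /q /v; field.
Qed.

Let codegree'E x y : codegree P W' x y = (1 + (v x + v y) + q x y) / 4.
Proof.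
rewrite /codegree (Eeq _ (g := fun z =>
  (1 / 4 + ((1 / 4) * (V x z + V y z) + (1 / 4) * (V x z * V y z))))); last first.
  by move=> z; rewrite /common_nbhd /W' /V; field.
rewrite ED; [|by bm..].
rewrite ED; [|by bm..].
rewrite (EZ P (1 / 4) (f := fun z => V x z + V y z)); [|by bm].
rewrite (EZ P (1 / 4)); [|by bm].
rewrite ED; [|by bm..].
by rewrite Ecst /q /v; field.
Qed.

Let kappa := E_ x, v x ^+ 2.

Let E_q : (E_ x, E_ y, q x y) = kappa.
Proof.
transitivity (E_ x, E_ z, V x z * v z).
  apply: Eeq => x; rewrite /q E_swap; last by bm.
  apply: Eeq => z; rewrite EZ; last by bm.
  by congr (_ * _); apply: Eeq => y; rewrite Vsym.
rewrite E_swap; last by bm.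
apply: Eeq => z; rewrite EZr; last by bm.
by rewrite expr2; congr (_ * _); apply: Eeq => y; rewrite Vsym.
Qed.

Let E_Vv : (E_ x, E_ y, V x y * (v x + v y)) = 2 * kappa.
Proof.
have e1 : (E_ x, E_ y, V x y * v x) = kappa.
  by apply: Eeq => x; rewrite EZr ?expr2//; bm.
have e2 : (E_ x, E_ y, V x y * v y) = kappa.
  rewrite -e1 E_swap; last by bm.
  by apply: Eeq => x; apply: Eeq => y; rewrite Vsym.
transitivity (E_ x, ((E_ y, V x y * v x) + (E_ y, V x y * v y))).
  apply: Eeq => x; rewrite -ED; [|by bm..].
  by apply: Eeq => y; rewrite mulrDr.
rewrite ED; [|by bm..].
by rewrite e1 e2; ring.
Qed.

Let E_vv : (E_ x, E_ y, v x ^+ 2 + v y ^+ 2) = 2 * kappa.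
Proof.
transitivity (E_ x, (v x ^+ 2 + kappa)).
  apply: Eeq => x; rewrite ED; [|by bm..].
  by rewrite Ecst.
rewrite ED; [|by bm..].
by rewrite Ecst /kappa; ring.
Qed.

(** For symmetric [C] this has the mean of [gain], by [E_nbhd_edges], but it is pointwise a
    polynomial in [V], [v] and [q]. *)
Let codegree_gain C x y : R :=
  128 * (C x y * codegree P C x y ^+ 2) - 8 * codegree P C x y - 16 * codegree P C x y ^+ 2.

(** The linear terms are exact; [- 10] bounds the quadratic remainder. A coefficient [- C] would do
    for [28/3 <= C <= 20]: the lower limit makes the remaining form nonnegative when [V ^+ 2 = 1],
    the upper one keeps the mean at least 2. *)
Lemma codegree_gain_ge x y :
  2 + (8 * q x y + (16 * (V x y * (v x + v y)) + (- 10) * (v x ^+ 2 + v y ^+ 2))) <=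
  codegree_gain W x y + codegree_gain W' x y.
Proof.
rewrite /codegree_gain codegreeE codegree'E.
have WV : W x y = (1 - V x y) / 2 by rewrite /V; field.
have W'V : W' x y = (1 + V x y) / 2 by rewrite /W' /V; field.
have V1 : 0 <= 1 - V x y ^+ 2.
  have -> : 1 - V x y ^+ 2 = 4 * (W x y * (1 - W x y)) by rewrite /V; ring.
  by have /andP[? ?] := W01 x y; rewrite !mulr_ge0// subr_ge0.
rewrite WV W'V -subr_ge0.
move: (V x y) (q x y) (v x) (v y) V1 => z b r s z1.
(* After completing the square in [b], what is left of the mixed term is
   absorbed by [(r + s) ^+ 2], as [z ^+ 2 <= 1] *)
rewrite (_ : _ - _ = 6 * (b + 4 / 3 * z * (r + s)) ^+ 2
  + 32 / 3 * ((1 - z ^+ 2) * (r + s) ^+ 2) + 1 / 3 * (r + s) ^+ 2 + 5 * (r - s) ^+ 2); last by field.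
have c1 : 0 <= 32 / 3 :> R by rewrite divr_ge0.
have c2 : 0 <= 1 / 3 :> R by rewrite divr_ge0.
apply: addr_ge0; last by rewrite mulr_ge0 ?sqr_ge0.
apply: addr_ge0; last by rewrite mulr_ge0 ?sqr_ge0.
apply: addr_ge0; first by rewrite mulr_ge0 ?sqr_ge0.
by apply: mulr_ge0 => //; apply: mulr_ge0 => //; exact: sqr_ge0.
Qed.

Lemma E_gain_ge : 2 <= (E_ x, E_ y, gain P W x y + gain P W' x y).
Proof.
have bc := bm_codegree P bW; have bc' := bm_codegree P bW'.
have be := bm_nbhd_edges P bW; have be' := bm_nbhd_edges P bW'.
have bg C (bC : bounded_measurable (fun p : T * T => C p.1 p.2)) :
    bounded_measurable (fun p : T * T => gain P C p.1 p.2).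
  have := bm_codegree P bC; have := bm_nbhd_edges P bC; rewrite /gain => ? ?; bm.
have bcg C (bC : bounded_measurable (fun p : T * T => C p.1 p.2)) :
    bounded_measurable (fun p : T * T => codegree_gain C p.1 p.2).
  have := bm_codegree P bC; rewrite /codegree_gain => ?; bm.
have E2D (F G : T -> T -> R) : bounded_measurable (fun p : T * T => F p.1 p.2) ->
    bounded_measurable (fun p : T * T => G p.1 p.2) ->
    (E_ x, E_ y, F x y + G x y) = (E_ x, E_ y, F x y) + (E_ x, E_ y, G x y).
  move=> bF bG; rewrite -ED; [|by bm..].
  by apply: Eeq => x; rewrite ED//; bm.
have E2Z (c : R) (F : T -> T -> R) : bounded_measurable (fun p : T * T => F p.1 p.2) ->
    (E_ x, E_ y, c * F x y) = c * (E_ x, E_ y, F x y).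
  move=> bF; rewrite -EZ; last by bm.
  by apply: Eeq => x; rewrite EZ//; bm.
have gainE C (bC : bounded_measurable (fun p : T * T => C p.1 p.2)) :
    (forall x y, C x y = C y x) ->
    (E_ x, E_ y, gain P C x y) = (E_ x, E_ y, codegree_gain C x y).
  move=> Csym; have bcC := bm_codegree P bC; have beC := bm_nbhd_edges P bC.
  transitivity (E_ x, E_ y, 128 * nbhd_edges P C x y +
      (- (8 * codegree P C x y + 16 * codegree P C x y ^+ 2))).
    by apply: Eeq => x; apply: Eeq => y; rewrite /gain; ring.
  rewrite (E2D (fun x y => 128 * nbhd_edges P C x y)); [|by bm..].
  rewrite E2Z// E_nbhd_edges// -E2Z; last by bm.
  rewrite -E2D; [|by bm..].
  by apply: Eeq => x; apply: Eeq => y; rewrite /codegree_gain; ring.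
have bgW := bg _ bW; have bgW' := bg _ bW'; have bcW := bcg _ bW; have bcW' := bcg _ bW'.
rewrite (E2D (gain P W) (gain P W') bgW bgW') (gainE W bW Wsym) (gainE W' bW' W'sym).
rewrite -(E2D (codegree_gain W) (codegree_gain W') bcW bcW').
have k0 : 0 <= kappa by apply: Ege0 => x; exact: sqr_ge0.
apply: (@le_trans _ _ (E_ x, E_ y, 2 + (8 * q x y +
    (16 * (V x y * (v x + v y)) + (- 10) * (v x ^+ 2 + v y ^+ 2))))).
  rewrite (E2D (fun _ _ => 2)); [|by bm..].
  rewrite (E2D (fun x y => 8 * q x y)); [|by bm..].
  rewrite (E2D (fun x y => 16 * (V x y * (v x + v y)))); [|by bm..].
  rewrite (E2Z 8 q) // (E2Z 16 (fun x y => V x y * (v x + v y))); last by bm.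
  rewrite (E2Z _ (fun x y => v x ^+ 2 + v y ^+ 2)); last by bm.
  (* The multiples of [kappa] add up to [8 + 32 - 20 = 20]. *)
  by rewrite E_q E_Vv E_vv !Ecst; lra.
apply: Ele; [by bm|by bm|] => x.
by apply: Ele; [by bm|by bm|] => y; exact: codegree_gain_ge.
Qed.

Lemma beachball_density k :
  2 / 8 ^+ (2 * k.+2) <=
  (E_ x, E_ y, nbhd_cycles P W (k.+1 + k.+1).+1 x y) +
  (E_ x, E_ y, nbhd_cycles P W' (k.+1 + k.+1).+1 x y).
Proof.
have bgain C : bounded_measurable (fun p : T * T => C p.1 p.2) ->
    bounded_measurable (fun p : T * T => gain P C p.1 p.2).
  move=> bC; have := bm_codegree P bC; have := bm_nbhd_edges P bC.
  by rewrite /gain => ? ?; bm.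
apply: (E_affine_lower_bound (bm_nbhd_cycles P bW _) (bm_nbhd_cycles P bW' _)
  (bgain _ bW) (bgain _ bW') _ _ E_gain_ge
  (nbhd_cycles_ge P bW Wsym W01 k) (nbhd_cycles_ge P bW' W'sym W'01 k)).
- by rewrite exprn_gt0.
- by rewrite divr_ge0.
Qed.

End TwoColours.
End TwoColourBeachball.

(** * Iterated integrals over the cube *)

(** A probability on the whole line, so that integrals over the unit interval become
    expectations. *)
Definition uniform01 (R : realType) : probability (measurableTypeR R) R :=
  uniform_prob (@ltr01 R).

Section CubeIntegral.
Context {R : realType}.
Implicit Types (g h : nat -> R) (f : (nat -> R) -> \bar R).

Local Notation unif := (uniform01 R).

Let itv01 (x : R) : x \in `[0, 1]%classic -> 0 <= x <= 1.
Proof. by rewrite inE /= in_itv. Qed.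

Lemma integral_unit_interval (H : R -> R) (F : measurableTypeR R -> R) : H =1 F ->
  bounded_measurable F -> (forall x, 0 <= F x) ->
  (\int[@lebesgue_measure R]_(x in `[0%R, 1%R]) (H x)%:E)%E = (\int[unif]_x F x)%R%:E.
Proof.
move=> /funext -> bF F0; rewrite -EFinE//.
rewrite integral_uniform => [| |x]; last by rewrite lee_fin.
  by rewrite subr0 invr1 mul1e.
by apply/measurable_EFinP; case: bF.
Qed.

Definition update h n x : nat -> R := fun i => if i == n then x else h i.

Lemma update_same h n x : update h n x n = x.
Proof. by rewrite /update eqxx. Qed.

Lemma update_neq h n x i : i != n -> update h n x i = h i.
Proof. by rewrite /update => /negbTE ->. Qed.

(** Coordinates from [n] on keep the default value 0 of [cube_integral]. *)
Lemma eq_cube_integral n f f' :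
  (forall g, (forall i, 0 <= g i <= 1) -> (forall i, (n <= i)%N -> g i = 0) -> f g = f' g) ->
  cube_integral n f = cube_integral n f'.
Proof.
elim: n f f' => [|n IH] f f' ff' /=; first by apply: ff' => // i; rewrite lexx ler01.
apply: eq_integral => x /itv01 x01; apply: IH => g g01 g0; apply: ff' => i.
  by case: ifP.
by move=> ni; rewrite gtn_eqF// g0// ltnW.
Qed.

(* [cube_integral] puts the last coordinate outermost; [G] records the
   successive results of integrating out coordinates 0, 1, ..., N-1. *)
Lemma cube_integral_inner N (G : nat -> (nat -> R) -> R) :
  (forall n h, (n < N)%N ->
    (\int[@lebesgue_measure R]_(x in `[0%R, 1%R]) (G n (update h n x))%:E)%E =
    (G n.+1 h)%:E) ->
  cube_integral N (fun g => (G 0%N g)%:E) = (G N (fun=> 0))%:E.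
Proof.
move=> step.
(* Coordinates below [n] are still integrated; the others are frozen at [h]. *)
pose merge n g h : nat -> R := fun i => if (i < n)%N then g i else h i.
have main n h : (n <= N)%N -> cube_integral n (fun g => (G 0%N (merge n g h))%:E) = (G n h)%:E.
  elim: n h => [//|n IH] h nN /=.
  rewrite -step//; apply: eq_integral => x _; rewrite -IH ?(ltnW nN)//.
  congr cube_integral; apply/funext => g; congr (G 0%N _)%:E; apply/funext => i.
  by rewrite /merge /update ltnS leq_eqVlt; have [->|] := eqVneq i n; rewrite ?ltnn.
rewrite -main//; apply: eq_cube_integral => g _ g0; congr (G 0%N _)%:E.
by apply/funext => i; rewrite /merge; case: ltnP => // /g0.
Qed.

End CubeIntegral.

(** * The beachball density as a weighted cycle density *)

Section BeachballDensity.
Context {R : realType}.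
Variable W : measurableTypeR R -> measurableTypeR R -> R.
Hypothesis bW : bounded_measurable (fun p : measurableTypeR R * measurableTypeR R => W p.1 p.2).
Hypothesis W01 : forall x y, 0 <= W x y <= 1.

Local Notation unif := (uniform01 R).
Let nbhd (h : nat -> R) n := common_nbhd W (h n.+2) (h n.+1).
Let wk (h : nat -> R) n := walk unif (nbhd h n) W.

(** The rim is [0..M], the poles are [M.+1] and [M.+2]. The vertices below [n] have been absorbed
    into a walk from [M] to [n]; for [n = 0] this walk is the closing edge of the rim. *)
Let remaining M n (h : nat -> R) : R :=
  (\prod_(n <= i < M.+1) nbhd h M (h i)) * (\prod_(n <= i < M) W (h i) (h i.+1)) *
  wk h M n (h M) (h n).

(** The stages are: rim vertices left, only the poles left, one pole left, nothing left. *)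
Let partial M n (h : nat -> R) : R :=
  if (n <= M)%N then remaining M n h
  else if n == M.+1 then nbhd_cycles unif W M (h M.+2) (h M.+1)
  else if n == M.+2 then (\int[unif]_x nbhd_cycles unif W M (h M.+2) x)%R
  else (\int[unif]_x \int[unif]_y nbhd_cycles unif W M x y)%R.

Lemma t_beachball M :
  t (beachball M.+1) W = (\int[unif]_x \int[unif]_y nbhd_cycles unif W M x y)%R%:E.
Proof.
have W0 x y : 0 <= W x y by case/andP: (W01 x y).
have bc : bounded_measurable (fun p : measurableTypeR R * measurableTypeR R => nbhd_cycles unif W M p.1 p.2).
  exact: bm_nbhd_cycles.
have c0 x y : 0 <= nbhd_cycles unif W M x y by exact: nbhd_cycles_ge0.
have pE n h : (n <= M)%N -> partial M n h = remaining M n h by rewrite /partial => ->.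
have p1 h : partial M M.+1 h = nbhd_cycles unif W M (h M.+2) (h M.+1).
  by rewrite /partial ltnn eqxx.
have p2 h : partial M M.+2 h = (\int[unif]_x nbhd_cycles unif W M (h M.+2) x)%R.
  by rewrite /partial ltnNge leqW// gtn_eqF// eqxx.
have p3 h : partial M M.+3 h = (\int[unif]_x \int[unif]_y nbhd_cycles unif W M x y)%R.
  by rewrite /partial !ifF//; lia.
rewrite -(p3 (fun=> 0)).
rewrite -(cube_integral_inner (N := M.+3)) => [|n h nM].
  apply: (@eq_cube_integral _ M.+3) => g _ _; congr (_%:E).
  rewrite pE// /remaining /gedges /beachball !big_cat !big_map.
  rewrite -[iota 0 M.+1]/(index_iota 0 M.+1).
  rewrite /= mulrC -big_split -mulrA; congr (_ * _).
    by apply: eq_bigr => i _; exact: mulrC.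
  (* The last rim edge wraps around to 0 and matches the walk without interior vertices. *)
  rewrite big_nat_recr//= modnn; congr (_ * _).
  by apply: eq_big_nat => i /andP[_ iM]; rewrite modn_small.
have bn a b : bounded_measurable (common_nbhd W a b) by exact: bm_common_nbhd.
have n0 a b u : 0 <= common_nbhd W a b u by case/andP: (common_nbhd01 W01 a b u).
have bwk a b m := bm_walk unif (bn a b) bW m.
have w0 a b m x y : 0 <= walk unif (common_nbhd W a b) W m x y by exact: walk_ge0.
case: (ltngtP n M) => [nltM|Mltn|->].
- have upd i x : (n < i)%N -> update h n x i = h i by move=> ?; rewrite update_neq// gtn_eqF.
  set c := (\prod_(n.+1 <= i < M.+1) nbhd h M (h i)) * (\prod_(n.+1 <= i < M) W (h i) (h i.+1)).
  (* Coordinate [n] occurs in the end of the walk, in its own weight and in the edge to [n.+1];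
     integrating it out lengthens the walk by one vertex. *)
  have Ec x : partial M n (update h n x) =
      c * (wk h M n (h M) x * nbhd h M x * W x (h n.+1)).
    rewrite pE 1?ltnW// /remaining big_ltn; last by rewrite ltnW.
    rewrite [in X in _ * X * _]big_ltn// /wk /nbhd update_same !upd; [|lia..].
    rewrite (eq_big_nat _ _ (F2 := fun i => common_nbhd W (h M.+2) (h M.+1) (h i))); last first.
      by move=> i /andP[ni _]; rewrite upd.
    rewrite [X in _ * (_ * X) * _](eq_big_nat _ _ (F2 := fun i => W (h i) (h i.+1))); last first.
      by move=> i /andP[ni _]; rewrite !upd// ltnW.
    by rewrite /c /nbhd; ring.
  rewrite (integral_unit_interval Ec) ?pE//; first last.
  + move=> x; rewrite mulr_ge0//.
      by apply: mulr_ge0; apply: prodr_ge0 => i _; [exact: n0|exact: W0].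
    by apply: mulr_ge0 => //; apply: mulr_ge0; [exact: w0|exact: n0].
  + have bn' := bn (h M.+2) (h M.+1); have bwk' := bwk (h M.+2) (h M.+1).
    by rewrite /wk /nbhd; bm.
  have bn' := bn (h M.+2) (h M.+1); have bwk' := bwk (h M.+2) (h M.+1).
  by rewrite EZ//; rewrite /wk /nbhd; bm.
- have [->|nM1] := eqVneq n M.+1.
    rewrite p2; apply: integral_unit_interval => [x||x]; [|by bm|exact: c0].
    by rewrite p1 update_same update_neq// gtn_eqF.
  have -> : n = M.+2 by lia.
  rewrite p3; apply: integral_unit_interval => [x||y].
  + by rewrite p2 update_same.
  + by bm.
  + by apply: Ege0 => x; exact: c0.
(* At the last rim vertex the walk is closed, and integrating its base point gives the cycle
   density. *)
- rewrite p1; apply: integral_unit_interval => [x||x].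
  + rewrite pE// /remaining big_nat1 big_geq// mulr1 /wk /nbhd update_same.
    by rewrite !update_neq// gtn_eqF.
  + by have bn' := bn (h M.+2) (h M.+1); have bwk' := bwk (h M.+2) (h M.+1); bm.
  + by apply: mulr_ge0; [exact: n0|exact: w0].
Qed.

End BeachballDensity.

(** * Extending a graphon beyond the unit square *)

Section Clamp.
Context {R : realType}.

(** A graphon is constrained only on the unit square; composing with this retraction gives a kernel
    with the same properties everywhere and the same densities. *)
Definition clamp (x : R) : R := Num.max 0 (Num.min x 1).

Lemma clamp01 x : 0 <= clamp x <= 1.
Proof. by rewrite /clamp le_max lexx/= ge_max ler01 ge_min lexx orbT. Qed.

Lemma clamp_id x : 0 <= x <= 1 -> clamp x = x.
Proof. by move=> /andP[x0 x1]; rewrite /clamp min_l// max_r. Qed.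

Lemma t_clamp H (W : R -> R -> R) : t H (fun x y => W (clamp x) (clamp y)) = t H W.
Proof.
apply: eq_cube_integral => g g01 _; congr (_%:E).
by apply: eq_bigr => uv _; rewrite !clamp_id.
Qed.

Lemma bm_clamp (W : R -> R -> R) : graphon W ->
  bounded_measurable (fun p : measurableTypeR R * measurableTypeR R => W (clamp p.1) (clamp p.2)).
Proof.
move=> [mW [_ W01]].
have memI x : clamp x \in `[0, 1] by rewrite in_itv clamp01.
split; last first.
  by exists 1 => p; have /andP[? ?] := W01 _ _ (memI p.1) (memI p.2); rewrite ger0_norm.
have mclamp : measurable_fun setT clamp.
  by apply: measurable_maxr => //; apply: measurable_minr.
have mW' : measurable_fun (`[0, 1]%classic `*` `[0, 1]%classic :
    set (measurableTypeR R * measurableTypeR R)) (fun p => W p.1 p.2) by exact: mW.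
have := @measurable_comp _ _ _ _ _ _ _ _ setT
  (fun p : measurableTypeR R * measurableTypeR R =>
     (clamp p.1, clamp p.2) : measurableTypeR R * measurableTypeR R) _ _ mW'.
apply.
- exact: measurableX.
- by move=> _ [p _ <-]; split; exact: memI.
- by apply: measurable_fun_pair; apply: measurableT_comp.
Qed.

End Clamp.

Theorem theorem4p3 (R : realType) (k : nat) :
  (2 <= k)%N -> common R (beachball (2 * k)).
Proof.
case: k => [|[|k]]// _ W gW; have [mW [Wsym W01]] := gW.
pose U x y := W (clamp x) (clamp y).
have memI (x : R) : clamp x \in `[0, 1] by rewrite in_itv clamp01.
have U01 x y : 0 <= U x y <= 1 by exact: W01.
have Usym x y : U x y = U y x by exact: Wsym.
have bU := bm_clamp gW.
pose U' x y := 1 - U x y.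
have bU' : bounded_measurable (fun p : measurableTypeR R * measurableTypeR R => U' p.1 p.2).
  by rewrite /U' /U; apply: bmD; [exact: bm_cst|exact: bmN].
have U'01 x y : 0 <= U' x y <= 1 by have := U01 x y; rewrite /U'; lra.
rewrite /m -(t_clamp _ W) -(t_clamp _ (fun x y => 1 - W x y)).
(* The rim length is written [M.+1] with [M = (k.+1 + k.+1).+1], the odd walk index of
   [beachball_density]. *)
have -> : (2 * k.+2)%N = ((k.+1 + k.+1).+1).+1 by lia.
rewrite (t_beachball (W := U) bU U01) (t_beachball (W := U') bU' U'01) -EFinD lee_fin.
(* Each rim vertex accounts for one rim edge and two spokes, hence a factor [2 ^+ 3]. *)
have -> : 2 ^+ e (beachball (k.+1 + k.+1).+2) = 8 ^+ (2 * k.+2) :> R.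
  rewrite /e !size_cat !size_map !size_iota.
  by rewrite (_ : 8 = 2 ^+ 3) -?exprM; [congr (_ ^+ _); lia|ring].
exact: (beachball_density (uniform01 R) (W := U) bU Usym U01).
Qed.
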